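(* Let $A$ be a real $N\times N$ matrix, not necessarily symmetric, which is positive definite, and let $B$ be a real symmetric positive definite $N\times N$ matrix. Assume there exist real numbers $\alpha,\beta>0$ such that $$\alpha\langle Bu,u\rangle\le\langle Au,u\rangle\le\beta\langle Bu,u\rangle\qquad\forall u\in\mathbb{R}^N .$$ Let $\tau>0$, let $\lambda_{\min}(B)$ and $\lambda_{\max}(B)$ be the smallest and largest eigenvalues of $B$, and set $$\delta=\|A-A^T\|,\qquad \Phi(\xi)=(\beta^2-2\alpha\tau)\,\xi+\frac{1}{4\xi}\delta^2 .$$ Assume that $\frac{\beta^2}{2\alpha}-\frac{\delta^2}{8\alpha\lambda_{\min}(B)^2}\ge0$. Consider, for $\Delta t>0$, the scheme $$\frac{u^{(k+1)}-u^{(k)}}{\Delta t}+\tau B\,(u^{(k+1)}-u^{(k)})=-Au^{(k)} .$$ Then the scheme has the following stability conditions: (i) If $\tau\ge\frac{\beta^2}{2\alpha}+\frac{\delta^2}{8\alpha\lambda_{\min}(B)^2}\ \left(\ge\frac{\beta^2}{2\alpha}\right)$, the scheme is unconditionally stable (stable for every $\Delta t>0$). (ii) If $\tau\le\frac{\beta^2}{2\alpha}-\frac{\delta^2}{8\alpha\lambda_{\max}(B)^2}$, the scheme is stable under the condition $0<\Delta t<\frac{2\alpha}{\Phi(\lambda_{\max}(B))}$. (iii) If $\frac{\beta^2}{2\alpha}-\frac{\delta^2}{8\alpha\lambda_{\max}(B)^2}\le\tau<\frac{\beta^2}{2\alpha}+\frac{\delta^2}{8\alpha\lambda_{\min}(B)^2}$,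 the scheme is stable under the condition $0<\Delta t<\frac{2\alpha}{\Phi(\lambda_{\min}(B))}$. (iv) If $\frac{\beta^2}{2\alpha}-\frac{\delta^2}{8\alpha\lambda_{\min}(B)^2}<\tau<\frac{\beta^2}{2\alpha}-\frac{\delta^2}{8\alpha\lambda_{\max}(B)^2}$, the scheme is stable under the condition $0<\Delta t<\frac{2\alpha}{\max\left(\Phi(\lambda_{\min}(B)),\,\Phi(\lambda_{\max}(B))\right)}$.
   Context: $\langle\cdot,\cdot\rangle$ is the Euclidean scalar product on $\mathbb{R}^N$ and $\|\cdot\|$ on matrices is the operator norm induced by the Euclidean norm. A real (possibly nonsymmetric) matrix $A$ is positive definite if $\langle Au,u\rangle>0$ for all $u\in\mathbb{R}^N\setminus\{0\}$. The scheme reads $u^{(k+1)}=Mu^{(k)}$ with iteration matrix $M=\mathrm{Id}-\Delta t(\mathrm{Id}+\tau\Delta t B)^{-1}A$; ''stable'' means that the spectral radius satisfies $\rho(M)<1$ (the eigenvalues of $M$ may be complex).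
   Formalization: In (ii) the threshold on τ uses λ_min(B) instead of λ_max(B): the printed (ii) is false, e.g. α=β=1, B=diag(1,1,2), A=[[1,1,0],[-1,1,0],[0,0,2]], τ=3/8, Δt=16/9; values of τ between the two thresholds are covered by (iii), (iv). *)

(* Defs.v *)
From HB Require Import structures.
From mathcomp Require Import all_boot all_order all_algebra.
From mathcomp Require Import classical_sets reals.
From mathcomp Require Import complex.

Set Implicit Arguments.
Unset Strict Implicit.
Unset Printing Implicit Defensive.

Import Order.TTheory GRing.Theory Num.Theory.
Local Open Scope ring_scope.
Local Open Scope classical_set_scope.

Section Definitions.
Variables (R : realType) (N : nat).
Implicit Types (A B M : 'M[R]_N) (u v : 'cV[R]_N).

Definition dot u v : R := \sum_(i < N) u i 0 * v i 0.

Definition enorm u : R := Num.sqrt (dot u u).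

(* The norm `|A| of MathComp-Analysis on matrices is the max norm, hence this
   separate definition. *)
Definition opnorm A : R := sup [set enorm (A *m u) | u in [set u | enorm u <= 1]].

(* Symmetry is not part of positive definiteness. *)
Definition posdef A := forall u, u != 0 -> 0 < dot (A *m u) u.

(* [eigenvalue] is about row vectors, but a square matrix and its transpose have
   the same eigenvalues.  The spectrum is finite, so the infima and suprema
   below are attained whenever it is not empty. *)
Definition lambda_min B : R := inf [set x | eigenvalue B x].
Definition lambda_max B : R := sup [set x | eigenvalue B x].

Definition spectral_radius M : R :=
  sup [set complex.Re `|z| | z in
    [set z : R[i] | eigenvalue (map_mx (real_complex R) M) z]].

Definition scheme_step A B (tau dt : R) u u' : Prop :=
  dt^-1 *: (u' - u) + tau *: (B *m (u' - u)) = - (A *m u).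

Definition iteration_mx A B (tau dt : R) : 'M[R]_N :=
  1%:M - dt *: (invmx (1%:M + (tau * dt) *: B) *m A).

Definition stable A B (tau dt : R) : Prop :=
  spectral_radius (iteration_mx A B tau dt) < 1.

(* If delta > 0 and c := beta^2 - 2 alpha tau > 0, Phi is convex on the positive
   reals with its minimum at delta / (2 sqrt c); if c <= 0 it is nonincreasing.
   So the maximum of Phi on [lmin, lmax] is Phi lmax for every lmax >= lmin
   exactly when c >= delta^2 / (4 lmin^2), i.e. when
     tau <= beta^2 / (2 alpha) - delta^2 / (8 alpha lmin^2).
   The weaker bound with lmax^2 instead of lmin^2 here does not suffice for
   stability when dt < 2 alpha / Phi lmax: with alpha = beta = 1, tau = 3/8,
   B = diag(1, 1, 2), A = B + K, where K e_2 = e_1, K e_1 = - e_2, K e_3 = 0, one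
   has delta = 2 and Phi 2 = 1, but for dt = 16/9 < 2 the iteration matrix has
   the eigenvalue -1/15 + 16/15 i, of modulus > 1. *)
Definition Phi (alpha beta tau delta xi : R) : R :=
  (beta ^+ 2 - 2 * alpha * tau) * xi + delta ^+ 2 / (4 * xi).

Lemma dotDl u v w : dot (u + v) w = dot u w + dot v w.
Proof.
rewrite /dot -big_split /=; apply: eq_bigr => i _.
by rewrite mxE mulrDl.
Qed.

Lemma dotZl a u v : dot (a *: u) v = a * dot u v.
Proof.
rewrite /dot mulr_sumr; apply: eq_bigr => i _.
by rewrite mxE mulrA.
Qed.

Lemma dot_ge0 u : 0 <= dot u u.
Proof. by apply: sumr_ge0 => i _; rewrite -expr2 sqr_ge0. Qed.

Lemma posdef_unitmx B (t : R) : posdef B -> 0 < t ->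
  1%:M + t *: B \in unitmx.
Proof.
move=> Bpos t0; rewrite -unitmx_tr -row_free_unit -kermx_eq0.
apply/eqP/row_matrixP => i; rewrite row0.
set w := row i _.
have : w *m (1%:M + t *: B)^T = 0 by apply/sub_kermxP; rewrite row_sub.
move/(congr1 trmx); rewrite trmx_mul trmxK trmx0 mulmxDl mul1mx -scalemxAl.
have [->//|w0 H] := eqVneq w 0.
have wT0 : w^T != 0 by rewrite -trmx0 (inj_eq trmx_inj).
have := congr1 (fun x => dot x w^T) H.
rewrite /= dotDl dotZl => E; suff: 0 < (0 : R) by rewrite ltxx.
have D0 : dot 0 w^T = 0 by rewrite -(scale0r 0) dotZl mul0r.
rewrite -[X in _ < X]D0 -E ltr_wpDl ?dot_ge0 // mulr_gt0 //.
exact: Bpos.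
Qed.

Lemma scheme_stepE A B (tau dt : R) u u' : posdef B -> 0 < tau -> 0 < dt ->
  scheme_step A B tau dt u u' <-> u' = iteration_mx A B tau dt *m u.
Proof.
move=> Bpos tau0 dt0; have dtN0 : dt != 0 by rewrite gt_eqF.
have U := posdef_unitmx Bpos (mulr_gt0 tau0 dt0).
rewrite /scheme_step /iteration_mx; set P := 1%:M + _ in U *.
have -> : dt^-1 *: (u' - u) + tau *: (B *m (u' - u)) = dt^-1 *: (P *m (u' - u)).
  rewrite /P mulmxDl mul1mx [RHS]scalerDr -scalemxAl [in RHS]scalerA.
  congr (_ + _ *: _).
  by rewrite mulrC mulfK.
rewrite mulmxBl mul1mx -scalemxAl -mulmxA; split.
  move=> /(congr1 (fun x => dt *: x)); rewrite scalerA divff // scale1r => H.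
  have := mulKmx U (u' - u); rewrite H scalerN mulmxN -scalemxAr => E.
  by rewrite E addrC subrK.
move=> ->; rewrite addrC addKr mulmxN -scalemxAr mulKVmx // scalerN.
by rewrite scalerA mulVf // scale1r.
Qed.

End Definitions.

(* Main.v *)
(* Let w = x + iy be an eigenvector of the iteration matrix M for z, and put
   n = |w|^2, b = <Bw, w>, <Aw, w> = a + ic.  Multiplying M w = z w by
   Id + tau dt B and pairing with w gives
     (1 - z) (n + tau dt b) = dt (a + ic),
   so |z| < 1 is equivalent to dt (a^2 + c^2) < 2 a (n + tau dt b).  Since
   alpha b <= a <= beta b and |c| <= delta n / 2, this follows from
   dt Phi(b / n) < 2 alpha, where b / n lies in [lmin, lmax] by the spectral
   theorem.  The four cases are bounds on Phi over [lmin, lmax]. *)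

Require Import Defs.
From HB Require Import structures.
From mathcomp Require Import all_boot all_order all_algebra.
From mathcomp Require Import classical_sets set_interval reals.
From mathcomp Require Import sesquilinear spectral complex.
From mathcomp Require Import ring lra.

Set Implicit Arguments.
Unset Strict Implicit.
Unset Printing Implicit Defensive.

Import Order.TTheory GRing.Theory Num.Theory.
Local Open Scope ring_scope.

(** * Suprema and infima of sets with finitely many elements *)

Section FiniteSup.
Variable R : realType.
Local Open Scope classical_set_scope.

Lemma sub_seq_has_ubound (E : set R) (s : seq R) :
  (forall x, E x -> x \in s) -> has_ubound E.
Proof.
move=> Es; exists (\big[Num.max/0]_(x <- s) x) => x /Es xs.
exact: le_bigmax_seq.
Qed.

(** Finiteness is what keeps the inequality strict in the limit: the members of [s] below [r],
    together with the witness [e], have a maximum that is still below [r] and dominates [E]. *)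
Lemma sub_seq_sup_lt (E : set R) (s : seq R) (r : R) :
  (forall x, E x -> x \in s) -> E !=set0 -> (forall x, E x -> x < r) ->
  sup E < r.
Proof.
move=> Es [e Ee] Er.
apply: (@le_lt_trans _ _ (\big[Num.max/e]_(x <- s | x < r) x)).
  apply: ge_sup; first by exists e.
  by move=> x Ex; apply: le_bigmax_seq; [exact: Es | exact: Er].
by rewrite big_tnth; apply: bigmax_lt => //; exact: Er.
Qed.

Lemma sub_seq_has_lbound (E : set R) (s : seq R) :
  (forall x, E x -> x \in s) -> has_lbound E.
Proof.
move=> Es; apply/has_lb_ubN; apply: (@sub_seq_has_ubound _ (map -%R s)).
by move=> _ [x /Es xs <-]; apply: map_f.
Qed.

Lemma sub_seq_inf_gt (E : set R) (s : seq R) (r : R) :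
  (forall x, E x -> x \in s) -> E !=set0 -> (forall x, E x -> r < x) ->
  r < inf E.
Proof.
move=> Es [e Ee] Er; rewrite /inf ltrNr.
apply: (@sub_seq_sup_lt _ (map -%R s)).
- by move=> _ [x /Es xs <-]; apply: map_f.
- by exists (- e), e.
- by move=> _ [x /Er rx <-]; rewrite ltrN2.
Qed.

End FiniteSup.

(** * Finiteness of spectra, and complex eigenvectors in real coordinates *)

Lemma eigenvalues_in_seq (F : closedFieldType) n (A : 'M[F]_n) :
  exists s : seq F, forall a, eigenvalue A a -> a \in s.
Proof.
have [s sE] := closed_field_poly_normal (char_poly A).
exists s => a; rewrite eigenvalue_root_char sE rootZ ?root_prod_XsubC //.
by rewrite (monicP (char_poly_monic A)) oner_eq0.
Qed.

(** The characteristic polynomial need not split over [R], so the list is taken over [R[i]] and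
    projected by the real part. *)
Lemma real_eigenvalues_in_seq (R : rcfType) n (A : 'M[R]_n) :
  exists s : seq R, forall a, eigenvalue A a -> a \in s.
Proof.
have [s sE] := eigenvalues_in_seq (map_mx (real_complex R) A).
exists (map (@complex.Re R) s) => a aE; apply/mapP;
exists (real_complex R a) => //.
by apply: sE; rewrite eigenvalue_map.
Qed.

Lemma eigenvalue_trmx (F : fieldType) n (A : 'M[F]_n) a :
  eigenvalue A^T a = eigenvalue A a.
Proof.
rewrite !eigenvalue_root_char; congr (root _ a).
rewrite /char_poly -[RHS]det_tr; congr (\det _).
by rewrite /char_poly_mx linearB /= tr_scalar_mx map_trmx.
Qed.

(** These are the real and imaginary parts of [M w = z w] for [w = x + iy]; passing to the transpose
    turns the row eigenvector into a column. *)
Lemma complex_eigenvector (R : rcfType) n (M : 'M[R]_n) (z : R[i]) :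
  eigenvalue (map_mx (real_complex R) M) z ->
  exists x y : 'cV[R]_n, [/\ (x != 0) || (y != 0),
    M *m x = complex.Re z *: x - complex.Im z *: y &
    M *m y = complex.Im z *: x + complex.Re z *: y].
Proof.
rewrite -eigenvalue_trmx => /eigenvalueP[v vM v0].
exists (\col_i complex.Re (v 0 i)), (\col_i complex.Im (v 0 i)).
have vME i : \sum_j v 0 j * (M i j)%:C%C = z * v 0 i.
  have /rowP/(_ i) := vM; rewrite !mxE => <-; apply: eq_bigr => j _.
  by rewrite !mxE.
have ReS (f : 'I_n -> R[i]) :
    complex.Re (\sum_j f j) = \sum_j complex.Re (f j).
  by apply: (big_morph (@complex.Re R)) => // -[a b] [c d].
have ImS (f : 'I_n -> R[i]) :
    complex.Im (\sum_j f j) = \sum_j complex.Im (f j).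
  by apply: (big_morph (@complex.Im R)) => // -[a b] [c d].
split.
- apply: contra_neqT v0; rewrite negb_or !negbK => /andP[/eqP x0 /eqP y0].
  apply/rowP => i; rewrite mxE; apply/eqP; rewrite eq_complex /=.
  have /colP/(_ i) := x0; rewrite !mxE => ->.
  by have /colP/(_ i) := y0; rewrite !mxE => ->; rewrite eqxx.
- apply/colP => i; rewrite !mxE.
  have /(congr1 (@complex.Re R)) := vME i; rewrite ReS.
  case: z {vM vME} (v 0 i) => [p q] [a b] /= <-.
  apply: eq_bigr => j _; rewrite !mxE; case: (v 0 j) => c d /=; ring.
- apply/colP => i; rewrite !mxE.
  have /(congr1 (@complex.Im R)) := vME i; rewrite ImS.
  case: z {vM vME} (v 0 i) => [p q] [a b] /=; rewrite addrC => <-.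
  apply: eq_bigr => j _; rewrite !mxE; case: (v 0 j) => c d /=; ring.
Qed.

(** * Euclidean product, operator norm and the skew part of a matrix *)

Section Dot.
Variables (R : realType) (n : nat).
Implicit Types (A B : 'M[R]_n) (u v w : 'cV[R]_n).

Lemma dotC u v : dot u v = dot v u.
Proof. by apply: eq_bigr => i _; rewrite mulrC. Qed.

Lemma dotDr u v w : dot w (u + v) = dot w u + dot w v.
Proof. by rewrite dotC dotDl !(dotC w). Qed.

Lemma dotZr a u v : dot u (a *: v) = a * dot u v.
Proof. by rewrite dotC dotZl dotC. Qed.

Lemma dotE u v : dot u v = (u^T *m v) 0 0.
Proof. by rewrite mxE; apply: eq_bigr => i _; rewrite mxE. Qed.

Lemma dot_trmx A u v : dot (A *m u) v = dot u (A^T *m v).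
Proof. by rewrite !dotE trmx_mul mulmxA. Qed.

Lemma dot_eq0 u : (dot u u == 0) = (u == 0).
Proof.
rewrite /dot psumr_eq0 => [|i _]; last by rewrite -expr2 sqr_ge0.
apply/allP/eqP => [u0|-> i _]; last by rewrite /= mxE mulr0.
apply/colP => i; have := u0 i (mem_index_enum i).
by rewrite /= mulf_eq0 orbb mxE => /eqP.
Qed.

Lemma dot_gt0 u : (0 < dot u u) = (u != 0).
Proof. by rewrite lt_def dot_ge0 dot_eq0 andbT. Qed.

Lemma dot_sqr_le u v : dot u v ^+ 2 <= dot u u * dot v v.
Proof.
have [->|v0] := eqVneq v 0.
  by rewrite -(scale0r (0 : 'cV_n)) !dotZr !mul0r expr0n mulr0.
have v_gt0 : 0 < dot v v by rewrite dot_gt0.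
(* This vector is [dot v v] times the component of [u] orthogonal to [v]; its squared norm is
   [dot v v] times the Cauchy-Schwarz defect. *)
have := dot_ge0 (dot v v *: u + (- dot u v) *: v).
rewrite !(dotDl, dotDr, dotZl, dotZr) (dotC v u) => H.
rewrite -subr_ge0 -(pmulr_rge0 _ v_gt0); apply: etrans H.
by congr (0 <= _); ring.
Qed.

Lemma enorm_ge0 u : 0 <= enorm u.
Proof. exact: sqrtr_ge0. Qed.

Lemma enorm_sqr u : enorm u ^+ 2 = dot u u.
Proof. by rewrite sqr_sqrtr ?dot_ge0. Qed.

Lemma enormZ a u : enorm (a *: u) = `|a| * enorm u.
Proof.
by rewrite /enorm dotZl dotZr mulrA -expr2 sqrtrM ?sqr_ge0 // sqrtr_sqr.
Qed.

Lemma enorm_gt0 u : (0 < enorm u) = (u != 0).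
Proof. by rewrite sqrtr_gt0 dot_gt0. Qed.

Lemma dot_le_enorm u v : `|dot u v| <= enorm u * enorm v.
Proof.
rewrite -(@ler_pXn2r _ 2) ?nnegrE ?mulr_ge0 ?enorm_ge0 ?normr_ge0 //.
by rewrite real_normK ?num_real // exprMn !enorm_sqr dot_sqr_le.
Qed.

Section OperatorNorm.
Local Open Scope classical_set_scope.

(** The Frobenius norm is a bound: Cauchy-Schwarz applies to each row of [A], and [F] adds up the
    squared row norms. *)
Lemma opnorm_set_ubound A :
  has_ubound [set enorm (A *m u) | u in [set u | enorm u <= 1]].
Proof.
pose F := \sum_i dot (row i A)^T (row i A)^T.
have F_ge0 : 0 <= F by apply: sumr_ge0 => i _; exact: dot_ge0.
exists (Num.sqrt F) => _ [u u1 <-]; apply: ler_wsqrtr.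
rewrite /dot; apply: ler_sum => i _.
have -> : (A *m u) i 0 = dot (row i A)^T u.
  by rewrite mxE; apply: eq_bigr => j _; rewrite !mxE.
rewrite -expr2; apply: le_trans (dot_sqr_le _ _) _.
by rewrite ler_piMr ?dot_ge0 // -enorm_sqr exprn_ile1 ?enorm_ge0.
Qed.

Lemma enorm_mulmx_le A u : enorm (A *m u) <= opnorm A * enorm u.
Proof.
have [->|u0] := eqVneq u 0.
  by rewrite mulmx0 -(scale0r (0 : 'cV_n)) enormZ normr0 !mul0r mulr0.
have nu : 0 < enorm u by rewrite enorm_gt0.
rewrite -ler_pdivrMr // mulrC.
have {1}-> : (enorm u)^-1 = `|(enorm u)^-1| by rewrite gtr0_norm ?invr_gt0.
rewrite -enormZ scalemxAr; apply: ub_le_sup; first exact: opnorm_set_ubound.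
exists ((enorm u)^-1 *: u) => //=.
by rewrite enormZ gtr0_norm ?invr_gt0 // mulVf ?gt_eqF.
Qed.

End OperatorNorm.

Lemma opnorm_ge0 A : 0 <= opnorm A.
Proof.
apply: le_trans (enorm_ge0 (A *m 0)) _.
apply: ub_le_sup; first exact: opnorm_set_ubound.
by exists 0 => //=; rewrite -(scale0r (0 : 'cV_n)) enormZ normr0 mul0r.
Qed.

(** Up to sign, the left side is the imaginary part of <Aw, w> for [w = x + iy], and only [A - A^T]
    contributes to it. Cauchy-Schwarz and the inequality 2st <= s^2 + t^2 then give the factor
    1/2. *)
Lemma dot_skew_le A (u v : 'cV[R]_n) :
  `|dot (A *m u) v - dot (A *m v) u| <=
  opnorm (A - A^T) * ((dot u u + dot v v) / 2).
Proof.
have -> : dot (A *m u) v - dot (A *m v) u = dot ((A - A^T) *m u) v.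
  rewrite mulmxBl -scaleN1r dotDl dotZl (dot_trmx A v) (dotC v); ring.
apply: le_trans (dot_le_enorm _ _) _.
apply: le_trans (ler_wpM2r (enorm_ge0 v) (enorm_mulmx_le _ _)) _.
rewrite -mulrA ler_wpM2l ?opnorm_ge0 // -!enorm_sqr.
by have := sqr_ge0 (enorm u - enorm v); nra.
Qed.

End Dot.

(** * Rayleigh quotient bounds from the spectral theorem *)

Section Rayleigh.
Variables (R : realType) (n : nat) (B : 'M[R]_n).
Hypothesis Bsym : B^T = B.

(** Over [R[i]], [B] is Hermitian, hence unitarily diagonalisable with real spectrum. The weights
    [c i] are the squared moduli of the coordinates of [x] in the eigenbasis, so both forms are real
    sums. *)
Lemma symmetric_spectral_form :
  exists d : 'I_n -> R, (forall i, eigenvalue B (d i)) /\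
  forall x : 'cV[R]_n, exists2 c : 'I_n -> R, (forall i, 0 <= c i) &
    dot (B *m x) x = \sum_i d i * c i /\ dot x x = \sum_i c i.
Proof.
pose C := R[i]; pose toC := real_complex R.
pose Bc := map_mx toC B.
have Bherm : Bc \is hermsymmx.
  apply: realsym_hermsym.
    by apply/is_hermitianmxP; rewrite expr0 scale1r map_mx_id // map_trmx Bsym.
  by apply/mxOverP => i j; rewrite mxE; apply/complex_realP; exists (B i j).
have /orthomx_spectralP := hermitian_normalmx Bherm.
have /mxOverP := hermitian_spectral_diag_real Bherm.
have Pu := spectral_unitarymx Bc; have Punit := spectral_unit Bc.
set P := spectralmx Bc in Pu Punit *; set sp := spectral_diag Bc.
move=> sp_real BcE.
pose d i := complex.Re (sp 0 i).
have dE i : toC (d i) = sp 0 i by apply: RRe_real.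
have invP := invmx_unitary Pu.
exists d; split=> [i|x].
  suff: eigenvalue Bc (sp 0 i) by rewrite -dE eigenvalue_map.
  (* Since [P *m Bc] equals [diag_mx sp *m P], the rows of [P] are left eigenvectors. *)
  apply/eigenvalueP; exists (row i P).
    rewrite -row_mul BcE !mulmxA mulmxV // mul1mx row_mul.
    by apply/rowP => j; rewrite row_diag_mx -scalemxAl -rowE.
  rewrite rowE mulmx_free_eq0 ?row_free_unit //.
  by apply/eqP => /rowP/(_ i)/eqP; rewrite !mxE !eqxx oner_eq0.
pose xc := map_mx toC x; pose y := P *m xc.
pose c i := complex.Re (y i 0) ^+ 2 + complex.Im (y i 0) ^+ 2.
exists c => [i|]; first by rewrite addr_ge0 ?sqr_ge0.
(* As [x] is real, its transpose is its adjoint, and [invmx P] is the adjoint of [P]. Taking for [e]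
   the spectrum gives [dot (B *m x) x]; the constant 1 gives [dot x x]. *)
have key (e : 'rV[C]_n) :
    (xc^T *m (invmx P *m diag_mx e *m P) *m xc) 0 0 =
    \sum_i e 0 i * toC (c i).
  have xcT : xc^T = map_mx Num.conj xc^T.
    apply/rowP => j; rewrite !mxE /toC; apply/esym/eqP.
    by rewrite eq_complex /= oppr0 !eqxx.
  rewrite xcT invP !mulmxA -map_mxM -trmx_mul -/y -mulmxA -/y mxE.
  apply: eq_bigr => j _; rewrite mul_mx_diag !mxE mulrAC mulrC.
  rewrite /toC /c add_Re2_Im2 normCK.
  by congr (_ * _); rewrite mulrC /y [in RHS]mxE.
have toC_dot (u v : 'cV[R]_n) :
    toC (dot u v) = ((map_mx toC u)^T *m map_mx toC v) 0 0.
  by rewrite map_trmx -map_mxM dotE [RHS]mxE.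
have toC_sum (f : 'I_n -> R) : toC (\sum_i f i) = \sum_i toC (f i).
  exact: rmorph_sum.
split; apply: (@complexI R); rewrite -/toC [RHS]toC_sum.
- rewrite dotC toC_dot map_mxM -/Bc -/xc mulmxA BcE key.
  by apply: eq_bigr => j _; rewrite -dE; exact/esym/rmorphM.
- have := key (const_mx 1); rewrite diag_const_mx mulmx1 mulVmx // mulmx1.
  rewrite -toC_dot => ->.
  by apply: eq_bigr => j _; rewrite mxE mul1r.
Qed.

Local Open Scope classical_set_scope.

Lemma eigenvalue_has_lbound (A : 'M[R]_n) : has_lbound [set x | eigenvalue A x].
Proof.
have [s sE] := real_eigenvalues_in_seq A; exact: sub_seq_has_lbound sE.
Qed.

Lemma eigenvalue_has_ubound (A : 'M[R]_n) : has_ubound [set x | eigenvalue A x].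
Proof.
have [s sE] := real_eigenvalues_in_seq A; exact: sub_seq_has_ubound sE.
Qed.

Lemma lambda_min_le_dot (x : 'cV[R]_n) :
  lambda_min B * dot x x <= dot (B *m x) x.
Proof.
have [d [dB /(_ x)[c c0 [-> ->]]]] := symmetric_spectral_form.
rewrite mulr_sumr; apply: ler_sum => i _; rewrite ler_wpM2r //.
by apply: ge_inf (dB i); exact: eigenvalue_has_lbound.
Qed.

Lemma dot_le_lambda_max (x : 'cV[R]_n) :
  dot (B *m x) x <= lambda_max B * dot x x.
Proof.
have [d [dB /(_ x)[c c0 [-> ->]]]] := symmetric_spectral_form.
rewrite mulr_sumr; apply: ler_sum => i _; rewrite ler_wpM2r //.
by apply: ub_le_sup (dB i); exact: eigenvalue_has_ubound.
Qed.

Lemma lambda_min_gt0 : (0 < n)%N -> posdef B -> 0 < lambda_min B.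
Proof.
move=> n0 Bpos; have [s sE] := real_eigenvalues_in_seq B.
apply: sub_seq_inf_gt sE _ _.
  (* Positive dimension makes the spectrum nonempty; the [inf] of the empty set would be 0. *)
  have [d [dB _]] := symmetric_spectral_form.
  by exists (d (Ordinal n0)); exact: dB.
move=> a /=; rewrite -eigenvalue_trmx => /eigenvalueP[v vB v0].
have vT0 : v^T != 0 by rewrite -trmx0 (inj_eq trmx_inj).
have := Bpos _ vT0; rewrite -[B]trmxK -trmx_mul vB linearZ /= dotZl.
by rewrite pmulr_lgt0 ?dot_gt0.
Qed.

End Rayleigh.

(** * Variation of [Phi] on an interval of positive reals *)

Section PhiVariation.
Variables (R : realType) (alpha beta tau delta : R).
Local Notation phi := (Phi alpha beta tau delta).
Local Notation K := (beta ^+ 2 - 2 * alpha * tau).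

(** This factorisation replaces the derivative: monotonicity between [u] and [v] is read off the
    sign of the second factor. *)
Lemma Phi_sub u v : 0 < u -> 0 < v ->
  phi v - phi u = (v - u) * (K - delta ^+ 2 / (4 * (u * v))).
Proof. by move=> u0 v0; rewrite /Phi; field; rewrite !gt_eqF. Qed.

Lemma ler_delta_div u v : 0 < u -> u <= v ->
  delta ^+ 2 / (4 * v) <= delta ^+ 2 / (4 * u).
Proof.
move=> u0 uv; rewrite ler_wpM2l ?sqr_ge0 //.
rewrite lef_pV2 ?posrE ?mulr_gt0 ?ler_pM2l //.
exact: lt_le_trans uv.
Qed.

(** If [phi] rises from [l] to [x], then [K] exceeds [delta ^+ 2 / (4 * (l * x))], hence also
    [delta ^+ 2 / (4 * (x * m))], so [phi] does not fall from [x] to [m]. *)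
Lemma Phi_le_max l x m : 0 < l -> l <= x -> x <= m ->
  phi x <= Num.max (phi l) (phi m).
Proof.
move=> l0 lx xm.
have x0 : 0 < x := lt_le_trans l0 lx; have m0 : 0 < m := lt_le_trans x0 xm.
rewrite le_max; have [//|lx'] := lerP (phi x) (phi l).
have kl : 0 < K - delta ^+ 2 / (4 * (l * x)).
  move: lx'; rewrite -subr_gt0 Phi_sub // => h.
  have xl : 0 <= x - l by rewrite subr_ge0.
  by rewrite ltNge; apply/negP => /(mulr_ge0_le0 xl); rewrite leNgt h.
rewrite /= -subr_ge0 Phi_sub //; apply: mulr_ge0; first by rewrite subr_ge0.
apply: le_trans (ltW kl) _; rewrite lerB // ler_delta_div ?mulr_gt0 //.
by rewrite mulrC ler_pM2l // (le_trans lx).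
Qed.

Lemma Phi_le_nondecreasing l m : 0 < l -> l <= m ->
  delta ^+ 2 / (4 * l ^+ 2) <= K -> phi l <= phi m.
Proof.
move=> l0 lm kl; have m0 : 0 < m := lt_le_trans l0 lm.
rewrite -subr_ge0 Phi_sub // mulr_ge0 ?subr_ge0 //.
by apply: le_trans kl; rewrite ler_delta_div ?exprn_gt0 // ler_pM2l.
Qed.

Lemma Phi_le_nonincreasing l m : 0 < l -> l <= m ->
  K <= delta ^+ 2 / (4 * m ^+ 2) -> phi m <= phi l.
Proof.
move=> l0 lm km; have m0 : 0 < m := lt_le_trans l0 lm.
rewrite -subr_le0 Phi_sub // mulr_ge0_le0 ?subr_ge0 ?subr_le0 //.
by apply: le_trans km _; rewrite ler_delta_div ?mulr_gt0 // ler_pM2r.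
Qed.

Lemma Phi_le0 l x : 0 < l -> l <= x ->
  K <= - (delta ^+ 2 / (4 * l ^+ 2)) -> phi x <= 0.
Proof.
move=> l0 lx kl; have x0 : 0 < x := lt_le_trans l0 lx.
have -> : phi x = (K + delta ^+ 2 / (4 * x ^+ 2)) * x.
  by rewrite /Phi; field; rewrite gt_eqF.
apply: mulr_le0_ge0 (ltW x0); rewrite -lerBrDr sub0r; apply: le_trans kl _.
rewrite lerN2 ler_delta_div ?exprn_gt0 //.
by rewrite ler_pXn2r ?nnegrE ?(ltW l0) ?(ltW x0).
Qed.

End PhiVariation.

(** * From a bound on [Phi] to the spectral radius *)

Section Stability.
Variables (R : realType) (n : nat) (A B : 'M[R]_n) (alpha beta tau dt : R).
Hypotheses (Bsym : B^T = B) (Bpos : posdef B).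
Hypotheses (alpha_gt0 : 0 < alpha) (tau_gt0 : 0 < tau) (dt_gt0 : 0 < dt).
Hypothesis AB : forall u : 'cV[R]_n,
  alpha * dot (B *m u) u <= dot (A *m u) u <= beta * dot (B *m u) u.
Local Notation delta := (opnorm (A - A^T)).
Local Notation P := (1%:M + (tau * dt) *: B).
Hypothesis Phi_lt : forall xi, lambda_min B <= xi <= lambda_max B -> 0 < xi ->
  dt * Phi alpha beta tau delta xi < 2 * alpha.

(** Multiplying by [P] removes the inverse from the iteration matrix. *)
Lemma iteration_mx_eigen (x y : 'cV[R]_n) (p q : R) :
  iteration_mx A B tau dt *m x = p *: x - q *: y ->
  dt *: (A *m x) = (1 - p) *: (P *m x) + q *: (P *m y).
Proof.
have Punit := posdef_unitmx Bpos (mulr_gt0 tau_gt0 dt_gt0).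
rewrite /iteration_mx mulmxBl mul1mx -scalemxAl -mulmxA.
move=> /(congr1 (mulmx P)); rewrite !mulmxBr -!scalemxAr mulKVmx // => H.
rewrite -[LHS](subKr (P *m x)) H scalerBl scale1r opprB addrA addrAC //.
Qed.

Lemma dot_P_sym (x y : 'cV[R]_n) : dot (P *m x) y = dot (P *m y) x.
Proof. by rewrite dot_trmx linearD /= linearZ /= Bsym trmx1 dotC. Qed.

Lemma dot_P (x : 'cV[R]_n) :
  dot (P *m x) x = dot x x + tau * dt * dot (B *m x) x.
Proof. by rewrite mulmxDl mul1mx -scalemxAl dotDl dotZl. Qed.

Lemma dot_B_ge0 (x : 'cV[R]_n) : 0 <= dot (B *m x) x.
Proof.
have [->|x0] := eqVneq x 0; last exact: ltW (Bpos x0).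
by rewrite mulmx0 -(scale0r (0 : 'cV_n)) dotZl mul0r.
Qed.

Lemma iteration_mx_eigenvalue_lt1 (z : R[i]) :
  eigenvalue (map_mx (real_complex R) (iteration_mx A B tau dt)) z ->
  complex.Re `|z| < 1.
Proof.
case/complex_eigenvector => x [y [xy0 Mx My]].
rewrite normc_def /=; case: z Mx My => p q /= Mx My.
have E1 := iteration_mx_eigen Mx.
(* The imaginary part has the shape of the real part with [x] and [y] exchanged and [q] replaced by
   [- q]. *)
have {My}E2 : dt *: (A *m y) = (1 - p) *: (P *m y) + (- q) *: (P *m x).
  by apply: iteration_mx_eigen; rewrite My scaleNr opprK addrC.
pose nn := dot x x + dot y y.
pose b := dot (B *m x) x + dot (B *m y) y.
pose a := dot (A *m x) x + dot (A *m y) y.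
pose c := dot (A *m x) y - dot (A *m y) x.
pose D := nn + tau * dt * b.
have n_gt0 : 0 < nn.
  rewrite /nn; case/orP: xy0 => h; first by rewrite ltr_wpDr ?dot_ge0 ?dot_gt0.
  by rewrite ltr_wpDl ?dot_ge0 ?dot_gt0.
have b_gt0 : 0 < b.
  rewrite /b; case/orP: xy0 => h; first by rewrite ltr_wpDr ?dot_B_ge0 ?Bpos.
  by rewrite ltr_wpDl ?dot_B_ge0 ?Bpos.
(* [aD] and [cD] are the real and imaginary parts of the equation paired with [w]; in each
   combination the cross terms cancel by symmetry of [P]. *)
have aD : dt * a = (1 - p) * D.
  have := congr1 (fun u => dot u x) E1; have := congr1 (fun u => dot u y) E2.
  rewrite /= !(dotDl, dotZl) (dot_P_sym y x) !dot_P => h1 h2.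
  rewrite /a mulrDr h1 h2 /D /nn /b; ring.
have cD : dt * c = q * D.
  have := congr1 (fun u => dot u y) E1; have := congr1 (fun u => dot u x) E2.
  rewrite /= !(dotDl, dotZl) (dot_P_sym y x) !dot_P => h1 h2.
  rewrite /c mulrBr h1 h2 /D /nn /b; ring.
have /andP[ab_l ab_u] : alpha * b <= a <= beta * b.
  have /andP[? ?] := AB x; have /andP[? ?] := AB y.
  by rewrite !mulrDr !lerD.
have c_le : c ^+ 2 <= delta ^+ 2 * nn ^+ 2 / 4.
  have := dot_skew_le A x y; rewrite -/c -/nn => h.
  rewrite -(real_normK (num_real c)).
  have := lerXn2r 2 (normr_ge0 c) _ h => /(_ _) /le_trans; apply.
    by rewrite nnegrE (le_trans (normr_ge0 _) h).
  by rewrite !exprMn le_eqVlt; apply/orP; left; apply/eqP; field.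
have b_min : lambda_min B * nn <= b.
  by rewrite mulrDr lerD // lambda_min_le_dot.
have b_max : b <= lambda_max B * nn.
  by rewrite mulrDr lerD // dot_le_lambda_max.
(* This is [Phi_lt] at the Rayleigh quotient [b / nn], multiplied by [b * nn]. *)
have main :
    dt * ((beta ^+ 2 - 2 * alpha * tau) * b ^+ 2 + delta ^+ 2 * nn ^+ 2 / 4) <
    2 * alpha * b * nn.
  have := @Phi_lt (b / nn); rewrite ler_pdivlMr // ler_pdivrMr // b_min b_max.
  move=> /(_ isT); rewrite divr_gt0 // => /(_ isT).
  rewrite -(ltr_pM2r (mulr_gt0 b_gt0 n_gt0)) mulrA /Phi; apply: etrans.
  congr (_ < _); field; rewrite ?gt_eqF //.
have D_gt0 : 0 < D by rewrite addr_gt0 ?mulr_gt0.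
have a_sqr : a ^+ 2 <= beta ^+ 2 * b ^+ 2.
  rewrite -exprMn lerXn2r ?nnegrE //.
    by apply: le_trans ab_l; rewrite mulr_ge0 ?ltW.
  by apply: le_trans ab_u; apply: le_trans ab_l; rewrite mulr_ge0 ?ltW.
have pq : p ^+ 2 + q ^+ 2 < 1.
  have D2 : 0 < D ^+ 2 by rewrite exprn_gt0.
  rewrite -(ltr_pM2r D2) mul1r.
  have -> : (p ^+ 2 + q ^+ 2) * D ^+ 2 = (D - dt * a) ^+ 2 + (dt * c) ^+ 2.
    by rewrite aD cD; ring.
  suff : dt * (a ^+ 2 + c ^+ 2) < 2 * a * D.
    move=> h; rewrite -subr_gt0.
    have -> : D ^+ 2 - ((D - dt * a) ^+ 2 + (dt * c) ^+ 2) =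
        dt * (2 * a * D - dt * (a ^+ 2 + c ^+ 2)) by ring.
    by rewrite mulr_gt0 // subr_gt0.
  apply: (@le_lt_trans _ _
    (dt * (beta ^+ 2 * b ^+ 2 + delta ^+ 2 * nn ^+ 2 / 4))).
    by rewrite ler_wpM2l ?lerD // ltW.
  (* The term [tau * dt * b] of [D] restores exactly the [2 * alpha * tau] subtracted in [main]. *)
  apply: (@lt_le_trans _ _ (2 * (alpha * b) * D)); first by rewrite /D; lra.
  by rewrite ler_pM2r // ler_pM2l.
by rewrite -[ltRHS]sqrtr1 ltr_sqrt.
Qed.

Lemma stable_of_Phi_lt : (0 < n)%N -> stable A B tau dt.
Proof.
move=> n0; rewrite /stable /spectral_radius.
set M := map_mx _ _.
have [s sE] := eigenvalues_in_seq M.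
apply: (@sub_seq_sup_lt _ _ (map (fun z : R[i] => complex.Re `|z|) s)).
- by move=> _ [z /sE zs <-]; apply: map_f.
(* [R[i]] is algebraically closed, so in positive dimension the set of moduli is nonempty. *)
- have [z zE] := eigenvalue_closed M n0; by exists (complex.Re `|z|), z.
- by move=> _ [z zE <-]; apply: iteration_mx_eigenvalue_lt1.
Qed.

End Stability.

(** * The four ranges of [tau] *)

Theorem theorem3p2 (R : realType) (N : nat) (A B : 'M[R]_N)
    (alpha beta tau : R)
    (hN : (0 < N)%N)
    (hA : posdef A)
    (hBsym : B^T = B)
    (hB : posdef B)
    (halpha : 0 < alpha)
    (hbeta : 0 < beta)
    (hAB : forall u : 'cV[R]_N,
       alpha * dot (B *m u) u <= dot (A *m u) u <= beta * dot (B *m u) u)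
    (htau : 0 < tau) :
  let lmin := lambda_min B in
  let lmax := lambda_max B in
  let delta := opnorm (A - A^T) in
  let phi := Phi alpha beta tau delta in
  let tau0 := beta ^+ 2 / (2 * alpha) in
  let gap xi := delta ^+ 2 / (8 * alpha * xi ^+ 2) in
  0 <= tau0 - gap lmin ->
  [/\ tau0 + gap lmin <= tau ->
        forall dt : R, 0 < dt -> stable A B tau dt,
      tau <= tau0 - gap lmin ->
        forall dt : R, 0 < dt -> dt < 2 * alpha / phi lmax ->
          stable A B tau dt,
      tau0 - gap lmax <= tau -> tau < tau0 + gap lmin ->
        forall dt : R, 0 < dt -> dt < 2 * alpha / phi lmin ->
          stable A B tau dt
    & tau0 - gap lmin < tau -> tau < tau0 - gap lmax ->
        forall dt : R, 0 < dt ->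
          dt < 2 * alpha / Num.max (phi lmin) (phi lmax) ->
          stable A B tau dt].
Proof.
move=> lmin lmax delta phi tau0 gap _.
have lmin_gt0 : 0 < lmin := lambda_min_gt0 hBsym hN hB.
have two_alpha : 0 < 2 * alpha by rewrite mulr_gt0.
(* With [gapE], this turns comparing the slope of [Phi] with [delta ^+ 2 / (4 * xi ^+ 2)] into
   comparing [tau0 - tau] with [gap xi]. *)
have K_tau : beta ^+ 2 - 2 * alpha * tau = 2 * alpha * (tau0 - tau).
  by rewrite /tau0; field; rewrite gt_eqF.
have gapE xi : 0 < xi -> delta ^+ 2 / (4 * xi ^+ 2) = 2 * alpha * gap xi.
  by move=> xi0; rewrite /gap; field; rewrite !gt_eqF.
have stable_of_bound dt X : 0 < dt ->
    (forall xi, lmin <= xi <= lmax -> phi xi <= X) -> dt * X < 2 * alpha ->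
    stable A B tau dt.
  move=> dt0 phiX dtX.
  apply: (@stable_of_Phi_lt _ _ _ _ alpha beta) => // xi xiE _.
  by apply: le_lt_trans dtX; rewrite ler_pM2l // phiX.
have stable_of_max dt X : 0 < dt -> dt < 2 * alpha / X ->
    (lmin <= lmax -> Num.max (phi lmin) (phi lmax) <= X) -> stable A B tau dt.
  move=> dt0 dtX maxX.
  (* A positive [dt] below [2 * alpha / X] forces [X > 0]; this also excludes [X = 0], where the
     quotient is 0 by convention. *)
  have X0 : 0 < X by have := lt_trans dt0 dtX; rewrite pmulr_rgt0 // invr_gt0.
  apply: (stable_of_bound dt X) => //; last by rewrite -ltr_pdivlMr.
  move=> xi /andP[l_xi xi_m]; apply: le_trans (maxX (le_trans l_xi xi_m)).
  exact: Phi_le_max.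
split.
- move=> tau_ge dt dt0.
  (* Here [phi <= 0] on the whole interval, so the bound 0 serves for every [dt]. *)
  apply: (stable_of_bound dt 0) => //; last by rewrite mulr0.
  move=> xi /andP[l_xi _]; apply: (Phi_le0 lmin_gt0 l_xi).
  by rewrite K_tau gapE // -mulrN ler_pM2l //; lra.
- move=> tau_le dt dt0 dt_lt; apply: stable_of_max dt_lt _ => // lm.
  (* The threshold with [gap lmin] makes [phi] nondecreasing from [lmin] on, so the maximum is
     [phi lmax]. *)
  rewrite ge_max lexx andbT Phi_le_nondecreasing //.
  by rewrite K_tau gapE // ler_pM2l //; lra.
- move=> tau_ge _ dt dt0 dt_lt; apply: stable_of_max dt_lt _ => // lm.
  (* The threshold with [gap lmax] makes [phi] nonincreasing up to [lmax], so the maximum is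
     [phi lmin]. *)
  rewrite ge_max lexx Phi_le_nonincreasing //.
  by rewrite K_tau gapE ?(lt_le_trans lmin_gt0) // ler_pM2l //; lra.
- by move=> _ _ dt dt0 dt_lt; apply: stable_of_max dt_lt _ => // _.
Qed.
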